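(* Let $\mathcal{A}$ be a unital $C^*$-algebra, $\mathcal{H}$ a Hilbert $\mathcal{A}$-module, $K\in End_{\mathcal{A}}^{*}(\mathcal{H})$, and $\mathbb{J}\subseteq\mathbb{N}$ a finite or countable index set. Let $\{T_i\}_{i\in\mathbb{J}}$ be a $K$-operator frame for $End_{\mathcal{A}}^{*}(\mathcal{H})$ with bounds $A$ and $B$. Let $\{R_i\}_{i\in\mathbb{J}}\subset End_{\mathcal{A}}^{*}(\mathcal{H})$ and $\alpha\ge0$. If $0\le\alpha<A$ and $$\Big\|\sum_{i\in\mathbb{J}}\langle(T_i-R_i)x,(T_i-R_i)x\rangle\Big\|\le\alpha\big\|\langle K^*x,K^*x\rangle\big\|\qquad\text{for all }x\in\mathcal{H},$$ then $\{R_i\}_{i\in\mathbb{J}}$ is a $K$-operator frame with frame bounds $A\big(1-\sqrt{\tfrac{\alpha}{A}}\big)^2$ and $B\big(1+\sqrt{\tfrac{\alpha}{A}}\big)^2$.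
   Context: Hilbert $\mathcal{A}$-modules are left modules with $\mathcal{A}$-valued inner product $\langle\cdot,\cdot\rangle$, $\mathcal{A}$-linear in the first variable, with $\langle x,y\rangle=\langle y,x\rangle^*$, complete for $\|x\|=\|\langle x,x\rangle\|^{1/2}$. $End_{\mathcal{A}}^{*}(\mathcal{H})$ is the set of adjointable operators on $\mathcal{H}$. Inequalities between elements of $\mathcal{A}$ refer to the usual order given by the positive cone of $\mathcal{A}$. For $K\in End_{\mathcal{A}}^{*}(\mathcal{H})$, a family $\{T_i\}_{i\in\mathbb{J}}\subset End_{\mathcal{A}}^{*}(\mathcal{H})$ is a $K$-operator frame for $End_{\mathcal{A}}^{*}(\mathcal{H})$ with (lower and upper) bounds $A,B>0$ if $A\langle K^*x,K^*x\rangle\le\sum_{i\in\mathbb{J}}\langle T_ix,T_ix\rangle\le B\langle x,x\rangle$ for all $x\in\mathcal{H}$. Convention: all series of the form $\sum_{i\in\mathbb{J}}\langle T_ix,T_ix\rangle$ are taken to converge in norm in $\mathcal{A}$ (i.e. $\{T_ix\}_i\in\ell^2(\mathcal{H})$, the Hilbert $\mathcal{A}$-module of sequences $\{x_i\}$ in $\mathcal{H}$ with $\sum_i\langle x_i,x_i\rangle$ norm convergent); this convergence is part of the notion of $K$-operator frame, and an inequality involving such series includes the assertion that the series appearing in it converge in norm. *)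

(* Defs.v *)
From HB Require Import structures.
From mathcomp Require Import all_boot all_order all_algebra.
From mathcomp Require Import complex.
From mathcomp Require Import boolp classical_sets reals topology normedtype sequences.

Set Implicit Arguments.
Unset Strict Implicit.
Unset Printing Implicit Defensive.
Import Order.TTheory GRing.Theory Num.Theory.
Import numFieldNormedType.Exports.
Local Open Scope ring_scope.
Local Open Scope complex_scope.
Local Open Scope classical_set_scope.

(* Hierarchy-Builder admits no common substructure of [algType] and
   [normedModType] (a missing join below [numDomainType]), so norms on
   C*-algebras and Hilbert modules are explicit R-valued functions. *)
Section Norms.
Context {R : realType} {V : zmodType}.
Variable N : V -> R.

Definition norm_cvg (u : nat -> V) (l : V) : Prop :=
  N (u n - l) @[n --> \oo] --> (0 : R).

Definition norm_cauchy (u : nat -> V) : Prop :=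
  forall e : R, 0 < e -> exists n0 : nat, forall m n : nat,
    (n0 <= m)%N -> (n0 <= n)%N -> N (u m - u n) < e.

Definition norm_complete : Prop :=
  forall u : nat -> V, norm_cauchy u -> exists l : V, norm_cvg u l.

End Norms.

(* Unital complex C*-algebras, over the complex numbers [R[i]]. *)
HB.mixin Record isCStarAlgebra (R : realType) A of GRing.Algebra R[i] A := {
  cnorm : A -> R;
  cnorm_eq0 : forall a : A, cnorm a = 0 -> a = 0;
  cnormD : forall a b : A, cnorm (a + b) <= cnorm a + cnorm b;
  cnormZ : forall (c : R[i]) (a : A), (cnorm (c *: a))%:C = `|c| * (cnorm a)%:C;
  cnormM : forall a b : A, cnorm (a * b) <= cnorm a * cnorm b;
  cnorm_complete : norm_complete cnorm;
  star : A -> A;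
  starK : forall a : A, star (star a) = a;
  starD : forall a b : A, star (a + b) = star a + star b;
  starZ : forall (c : R[i]) (a : A), star (c *: a) = c^* *: star a;
  starM : forall a b : A, star (a * b) = star b * star a;
  cnorm_star : forall a : A, cnorm (star a * a) = cnorm a ^+ 2
}.

#[short(type="cstarAlgType")]
HB.structure Definition CStarAlgebra (R : realType) :=
  {A of GRing.Algebra R[i] A & isCStarAlgebra R A}.

Section CStarOrder.
Context {R : realType} {A : cstarAlgType R}.

Definition invertible (a : A) : Prop := exists b : A, a * b = 1 /\ b * a = 1.

Definition spectrum (a : A) : set R[i] :=
  [set z : R[i] | ~ invertible (z%:A - a)].

(* In the order of [R[i]], [0 <= z] means that z is real and nonnegative. *)
Definition cstar_pos (a : A) : Prop :=
  star a = a /\ forall z : R[i], spectrum a z -> 0 <= z.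

Definition cstar_le (a b : A) : Prop := cstar_pos (b - a).

End CStarOrder.

Notation "a <=* b" := (cstar_le a b) (at level 70, no associativity) : ring_scope.

(* Left Hilbert modules. The complex vector space structure of H is the one
   forced by the unital A-module structure, namely c x = (c 1) x. *)
HB.mixin Record isHilbertModule (R : realType) (A : cstarAlgType R) H
    of GRing.Lmodule A H := {
  inner : H -> H -> A;
  inner_linear : forall (a : A) (x y z : H),
    inner (a *: x + y) z = a * inner x z + inner y z;
  inner_star : forall x y : H, inner x y = star (inner y x);
  inner_ge0 : forall x : H, cstar_pos (inner x x);
  inner_eq0 : forall x : H, inner x x = 0 -> x = 0;
  inner_complete : norm_complete (fun x : H => Num.sqrt (cnorm (inner x x)))
}.

#[short(type="hilbertModType")]
HB.structure Definition HilbertModule (R : realType) (A : cstarAlgType R) :=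
  {H of GRing.Lmodule A H & isHilbertModule R A H}.

Definition is_adjoint (R : realType) (A : cstarAlgType R)
    (H : hilbertModType A) (T T' : H -> H) : Prop :=
  forall x y : H, inner (T x) y = inner x (T' y).

Record adjointable (R : realType) (A : cstarAlgType R)
    (H : hilbertModType A) := Adjointable {
  adj_fun :> H -> H;
  adj_ex : exists T' : H -> H, is_adjoint adj_fun T'
}.

Notation "''End*' ( H )" := (adjointable H)
  (at level 8, format "''End*' ( H )") : type_scope.

Section Frames.
Context {R : realType} {A : cstarAlgType R} {H : hilbertModType A}.

Definition adjoint (T : 'End*(H)) : H -> H := projT1 (cid (adj_ex T)).

Lemma adjointP (T : 'End*(H)) : is_adjoint T (adjoint T).
Proof. exact: (projT2 (cid (adj_ex T))). Qed.

(* [frame_sum J T x s]: the series of the <T_i x, T_i x>, i in J, converges in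
   norm to s. A family indexed by J is a family on nat whose values outside J
   play no role. The terms are positive, so convergence and sum do not depend
   on the order of summation. *)
Definition frame_sum (J : set nat) (T : nat -> H -> H) (x : H) (s : A) : Prop :=
  norm_cvg cnorm
    (fun n => \sum_(0 <= i < n | i \in J) inner (T i x) (T i x)) s.

Definition K_operator_frame (K : 'End*(H)) (J : set nat)
    (T : nat -> 'End*(H)) (a b : R) : Prop :=
  [/\ 0 < a, 0 < b &
   forall x : H, exists s : A,
     [/\ frame_sum J T x s,
         a%:C *: inner (adjoint K x) (adjoint K x) <=* s &
         s <=* b%:C *: inner x x]].

End Frames.

(* Main.v *)
(* Let D_i = T_i - R_i and d = sum <D_i x, D_i x>. The norm hypothesis applied to
   all multiples c^-1 x, with c^2 = <K^* x, K^* x> + eps, implies to the operator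
   inequality d <= alpha <K^* x, K^* x> <= r^2 u, where u = sum <T_i x, T_i x> and
   r = sqrt (alpha / A). Expanding <T_i x +- t^-1 D_i x, T_i x +- t^-1 D_i x> >= 0
   gives
     (1 - t) u + (1 - t^-1) d <= sum <R_i x, R_i x> <= (1 + t) u + (1 + t^-1) d,
   and d <= t^2 u for t > r turns the two sides into (1 - t)^2 u and (1 + t)^2 u;
   then t tends to r.
   The order theory of A rests on one fact: for self-adjoint h, one of |h| and
   -|h| is in the spectrum of h. Hence, for self-adjoint p and M >= |p|, p is
   positive iff |M - p| <= M, which shows that the positive cone is convex and
   closed. *)

Require Import Defs.
From HB Require Import structures.
From mathcomp Require Import all_boot all_order all_algebra.
From mathcomp Require Import complex.
From mathcomp Require Import boolp classical_sets reals topology normedtype sequences.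
From mathcomp Require Import ring lra.
Import Order.TTheory GRing.Theory Num.Theory.
Import numFieldNormedType.Exports.
Local Open Scope complex_scope.
Local Open Scope ring_scope.

Set Implicit Arguments.
Unset Strict Implicit.
Unset Printing Implicit Defensive.

Local Notation "r *:r x" := (r%:C *: x) (at level 40).
Local Notation "r %:S" := (r%:C *: 1) (at level 2, format "r %:S").

(** * Epsilon form of convergence in norm *)

Section NormConvergence.
Context {R : realType} {V : zmodType}.
Variable N : V -> R.
Hypothesis N_ge0 : forall x, 0 <= N x.

Lemma norm_cvgP (u : nat -> V) (l : V) : norm_cvg N u l <->
  forall e : R, 0 < e -> exists n0, forall n, (n0 <= n)%N -> N (u n - l) < e.
Proof.
rewrite /norm_cvg; split=> [ul e e0|ul].
  have [n0 _ hn0] := cvgr0_norm_lt _ ul _ e0.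
  by exists n0 => n /hn0; rewrite /= ger0_norm.
apply/cvgr0Pnorm_lt => e e0; have [n0 hn0] := ul e e0.
by exists n0 => // n /hn0; rewrite /= ger0_norm.
Qed.

End NormConvergence.

(** * Norm and involution; fixed points of contractions *)

Section CStarNorm.
Context {R : realType} {A : cstarAlgType R}.
Implicit Types (a b : A) (r : R).

Lemma cnorm_realZ r a : cnorm (r *:r a) = `|r| * cnorm a.
Proof.
apply: complexI; rewrite cnormZ normc_def /= expr0n /= addr0 sqrtr_sqr.
by rewrite rmorphM.
Qed.

Lemma cnorm0 : cnorm (0 : A) = 0.
Proof. by have := cnorm_realZ 0 0; rewrite scaler0 normr0 mul0r. Qed.

Lemma cnormN a : cnorm (- a) = cnorm a.
Proof.
have -> : - a = (-1) *:r a by rewrite rmorphN rmorph1 scaleN1r.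
by rewrite cnorm_realZ normrN1 mul1r.
Qed.

Lemma cnorm_ge0 a : 0 <= cnorm a.
Proof.
by have := cnormD a (- a); rewrite subrr cnorm0 cnormN; lra.
Qed.

Lemma cnormB a b : cnorm (a - b) <= cnorm a + cnorm b.
Proof. by rewrite -(cnormN b) cnormD. Qed.

Lemma cnorm_distrC a b : cnorm (a - b) = cnorm (b - a).
Proof. by rewrite -cnormN opprB. Qed.

Lemma cnorm_dist_triangle b a c :
  cnorm (a - c) <= cnorm (a - b) + cnorm (b - c).
Proof. by have := cnormD (a - b) (b - c); rewrite addrA subrK. Qed.

Lemma star_realZ r a : star (r *:r a) = r *:r star a.
Proof. by rewrite starZ -[in RHS](conjc_real r). Qed.

Lemma star1 : star (1 : A) = 1.
Proof. by rewrite -[RHS](starK 1) -[in RHS](mulr1 (star 1)) starM starK mulr1. Qed.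

Lemma star0 : star (0 : A) = 0.
Proof. by have := star_realZ 0 0; rewrite !scale0r. Qed.

Lemma starN a : star (- a) = - star a.
Proof. by apply/eqP; rewrite -addr_eq0 -starD addNr star0. Qed.

Lemma starB a b : star (a - b) = star a - star b.
Proof. by rewrite starD starN. Qed.

Lemma star_real r : star (r%:S : A) = r%:S.
Proof. by rewrite star_realZ star1. Qed.

Lemma starX a n : star (a ^+ n) = star a ^+ n.
Proof.
elim: n => [|n IH]; first by rewrite !expr0 star1.
by rewrite exprSr starM IH exprS.
Qed.

(** |b|^2 = |b^* b| <= |b^*| |b|; cancelling |b| gives one inequality, and the same for b^* gives
    the other. *)
Lemma cnorm_starE a : cnorm (star a) = cnorm a.
Proof.
suff le b : cnorm b <= cnorm (star b).
  by apply/eqP; rewrite eq_le le andbT -{2}(starK a) le.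
have [->|b0] := eqVneq (cnorm b) 0; first exact: cnorm_ge0.
have bpos : 0 < cnorm b by rewrite lt_neqAle eq_sym b0 cnorm_ge0.
by rewrite -(ler_pM2r bpos) -expr2 -cnorm_star cnormM.
Qed.

Lemma cnorm1 : cnorm (1 : A) = 1.
Proof.
have n1 : cnorm (1 : A) != 0.
  by apply/eqP => /cnorm_eq0/eqP; rewrite oner_eq0.
apply: (mulfI n1); rewrite mulr1 -expr2 -cnorm_star.
by rewrite star1 mulr1.
Qed.

Lemma cnorm_real r : cnorm (r%:S : A) = `|r|.
Proof. by rewrite cnorm_realZ cnorm1 mulr1. Qed.

Lemma cnorm_sqr_sa a : star a = a -> cnorm (a * a) = cnorm a ^+ 2.
Proof. by move=> sa; rewrite -cnorm_star sa. Qed.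

Lemma realMl r a : r%:S * a = r *:r a.
Proof. by rewrite -scalerAl mul1r. Qed.

Lemma realMr r a : a * r%:S = r *:r a.
Proof. by rewrite -scalerAr mulr1. Qed.

Lemma realZD r s a : (r + s) *:r a = r *:r a + s *:r a.
Proof. by rewrite rmorphD scalerDl. Qed.

Lemma realZB r s a : (r - s) *:r a = r *:r a - s *:r a.
Proof. by rewrite rmorphB scalerBl. Qed.

Lemma realZA r s a : r *:r (s *:r a) = (r * s) *:r a.
Proof. by rewrite rmorphM scalerA. Qed.

Lemma realZN r a : (- r) *:r a = - (r *:r a).
Proof. by rewrite rmorphN scaleNr. Qed.

Lemma realZ1 a : 1 *:r a = a.
Proof. by rewrite rmorph1 scale1r. Qed.

Lemma cnorm_cvgP (u : nat -> A) (l : A) : norm_cvg cnorm u l <->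
  forall e : R, 0 < e -> exists n0, forall n, (n0 <= n)%N ->
    cnorm (u n - l) < e.
Proof. exact: norm_cvgP cnorm_ge0 _ _. Qed.

Lemma cnorm_cvg_unique (u : nat -> A) l l' :
  norm_cvg cnorm u l -> norm_cvg cnorm u l' -> l = l'.
Proof.
move=> /cnorm_cvgP ul /cnorm_cvgP ul'; apply/eqP; rewrite -subr_eq0.
apply/eqP/cnorm_eq0/eqP; rewrite eq_le cnorm_ge0 andbT.
apply/ler_addgt0Pr => e e0; rewrite add0r.
have e20 : 0 < e / 2 by lra.
have [n hn] := ul _ e20; have [m hm] := ul' _ e20.
have := hn (maxn n m) (leq_maxl _ _); have := hm (maxn n m) (leq_maxr _ _).
have := cnorm_dist_triangle (u (maxn n m)) l l'; rewrite (cnorm_distrC l (u _)).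
by lra.
Qed.

Lemma cnorm_cvg_lipschitz (f : A -> A) (c : R) (u : nat -> A) l :
    (forall a b, cnorm (f a - f b) <= c * cnorm (a - b)) ->
  norm_cvg cnorm u l -> norm_cvg cnorm (fun n => f (u n)) (f l).
Proof.
move=> fc /cnorm_cvgP ul; apply/cnorm_cvgP => e e0.
(* The sign of [c] is arbitrary, so |c| + 1 serves as a positive Lipschitz constant. *)
have c0 : 0 < `|c| + 1 by have := normr_ge0 c; lra.
have [n0 hn] := ul _ (divr_gt0 e0 c0); exists n0 => n /hn.
rewrite ltr_pdivlMr // mulrC; apply: le_lt_trans; apply: le_trans (fc _ _) _.
apply: ler_wpM2r; first exact: cnorm_ge0.
by have := ler_norm c; lra.
Qed.

(* On the ball, f^n contracts distances by rho^n, so that the orbit of 0 is a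
   Cauchy sequence. *)
Lemma ball_fixpoint (f : A -> A) (rho c : R) :
    0 <= rho < 1 -> 0 <= c ->
    (forall a, cnorm a <= c -> cnorm (f a) <= c) ->
    (forall a b, cnorm a <= c -> cnorm b <= c ->
       cnorm (f a - f b) <= rho * cnorm (a - b)) ->
  exists2 l, cnorm l <= c & f l = l.
Proof.
move=> /andP[rho0 rho1] c0 fball fcontr.
pose u n := iter n f 0.
have uball n : cnorm (u n) <= c.
  by elim: n => [|n IH]; [rewrite cnorm0 | rewrite /u iterS fball].
have uc n m k : cnorm (u (n + m)%N - u (n + k)%N) <= rho ^+ n * (2 * c).
  elim: n => [|n IH].
    rewrite expr0 mul1r; apply: le_trans (cnormB _ _) _.
    by have := uball m; have := uball k; rewrite !add0n; lra.
  rewrite !addSn /u !iterS; apply: le_trans (fcontr _ _ (uball _) (uball _)) _.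
  by rewrite exprS -mulrA ler_wpM2l.
have ucauchy : norm_cauchy cnorm u.
  move=> e e0; have c20 : 0 < 2 * c + 1 by lra.
  have rhoN : `|rho| < 1 by rewrite ger0_norm.
  have [n _ hn] := cvgr0_norm_lt _ (cvg_expr rhoN) _ (divr_gt0 e0 c20).
  exists n => m k /subnKC <- /subnKC <-; apply: le_lt_trans (uc _ _ _) _.
  have := hn n (leqnn _); rewrite /= ger0_norm ?exprn_ge0// ltr_pdivlMr//.
  by apply: le_lt_trans; rewrite ler_wpM2l ?exprn_ge0//; lra.
have [l /cnorm_cvgP ul] := cnorm_complete _ ucauchy.
have lball : cnorm l <= c.
  apply/ler_addgt0Pr => e /ul[n /(_ n (leqnn _))].
  have := cnormB (u n) (u n - l); rewrite subKr.
  by have := uball n; lra.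
(* Both [f l] and [l] are limits of the shifted orbit. *)
exists l => //; apply: (@cnorm_cvg_unique (fun n => u n.+1)); apply/cnorm_cvgP.
  move=> e /ul[n0 hn]; exists n0 => n /hn; apply: le_lt_trans.
  rewrite /u iterS; apply: le_trans (fcontr _ _ (uball _) lball) _.
  by rewrite ler_piMl ?cnorm_ge0// ltW.
by move=> e /ul[n0 hn]; exists n0 => n /leqW/hn.
Qed.

End CStarNorm.

(** * Neumann series and invertible elements *)

Section Invertibility.
Context {R : realType} {A : cstarAlgType R}.
Implicit Types (a b h p : A) (r t : R).

Lemma invertibleM a b : invertible a -> invertible b -> invertible (a * b).
Proof.
move=> [a' [aa' a'a]] [b' [bb' b'b]]; exists (b' * a').
by rewrite -mulrA [b * _]mulrA bb' mul1r aa' -mulrA [a' * _]mulrA a'a mul1r.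
Qed.

Lemma invertibleN a : invertible (- a) <-> invertible a.
Proof.
by split=> -[b [ab ba]]; exists (- b); rewrite !(mulrN, mulNr) ?opprK;
  rewrite ?mulNr ?mulrN in ab ba.
Qed.

Lemma invertibleZ (c : R[i]) a : c != 0 -> invertible a -> invertible (c *: a).
Proof.
move=> c0 [b [ab ba]]; exists (c^-1 *: b).
by rewrite -!scalerAl -!scalerAr !scalerA ab ba mulfV// mulVf// scale1r.
Qed.

Lemma left_right_invertible a b c : a * b = 1 -> c * a = 1 -> invertible a.
Proof.
move=> ab ca; exists b; split=> //.
by rewrite -[b]mul1r -ca -[c * a * b]mulrA ab mulr1.
Qed.

(** The maps x -> 1 + a x and x -> 1 + x a contract the ball of radius 1 / (1 - |a|) into itself
    with factor |a|; their fixed points are a right and a left inverse of 1 - a. *)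
Lemma neumann1 a : cnorm a < 1 -> invertible (1 - a).
Proof.
move=> a1; have c0 : 0 < 1 - cnorm a by lra.
have ra : 0 <= cnorm a < 1 by rewrite cnorm_ge0.
have cE : 1 + cnorm a * (1 - cnorm a)^-1 = (1 - cnorm a)^-1.
  by field; rewrite gt_eqF.
have ball (x : A) : cnorm x <= cnorm a * (1 - cnorm a)^-1 ->
    cnorm (1 + x) <= (1 - cnorm a)^-1.
  by move=> xa; apply: le_trans (cnormD _ _) _; rewrite cnorm1 -cE lerD2l.
have ic0 : 0 <= (1 - cnorm a)^-1 by rewrite invr_ge0 ltW.
have [| |b _ bE] := @ball_fixpoint R A (fun x => 1 + a * x) _ _ ra ic0.
- move=> x xc; apply: ball; apply: le_trans (cnormM _ _) _.
  by rewrite ler_wpM2l ?cnorm_ge0.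
- by move=> x y _ _; rewrite opprD addrACA subrr add0r -mulrBr cnormM.
have [| |c _ cE'] := @ball_fixpoint R A (fun x => 1 + x * a) _ _ ra ic0.
- move=> x xc; apply: ball; apply: le_trans (cnormM _ _) _.
  by rewrite mulrC ler_wpM2l ?cnorm_ge0.
- move=> x y _ _; rewrite opprD addrACA subrr add0r -mulrBl mulrC.
  exact: cnormM.
apply: (@left_right_invertible _ b c).
  by rewrite mulrBl mul1r -{1}bE addrK.
by rewrite mulrBr mulr1 -{1}cE' addrK.
Qed.

Lemma neumann (c : R[i]) a : (cnorm a)%:C < `|c| -> invertible (c *: 1 - a).
Proof.
move=> ac; have c0 : 0 < `|c| by apply: le_lt_trans ac; rewrite lecR cnorm_ge0.
have cn0 : c != 0 by rewrite -normr_gt0.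
have -> : c *: 1 - a = c *: (1 - c^-1 *: a).
  by rewrite scalerBr scalerA mulfV// scale1r.
apply: invertibleZ => //; apply: neumann1.
by rewrite -ltcR cnormZ normfV mulrC ltr_pdivrMr// mul1r.
Qed.

Lemma neumann_real r a : cnorm a < `|r| -> invertible (r%:S - a).
Proof.
by move=> ar; apply: neumann; rewrite normc_def /= expr0n /= addr0 sqrtr_sqr ltcR.
Qed.

Lemma starZi r a : star ((0 +i* r) *: a) = - ((0 +i* r) *: star a).
Proof.
rewrite starZ -scaleNr; congr (_ *: _).
by apply/eqP; rewrite eq_complex /= oppr0 !eqxx.
Qed.

Lemma sqr_add_imag h r : star h = h ->
  star (h + (0 +i* r) *: 1) * (h + (0 +i* r) *: 1) = h * h + (r ^+ 2)%:S.
Proof.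
move=> sh; rewrite starD sh starZi star1 mulrDr !mulrDl.
rewrite -!scalerAr !mulNr -!scalerAl mul1r !mulr1.
rewrite addrA -[_ - _ + _]addrA addNr addr0 scalerN -scaleNr scalerA.
congr (_ + _ *: _).
by apply/eqP; rewrite eq_complex /=; apply/andP; split; apply/eqP; ring.
Qed.

(* If h + i r were not invertible, then |h + i s| would be at least |s - r|
   for all real s, while |h + i s|^2 <= |h|^2 + s^2. *)
Lemma invertible_add_imag h r : star h = h -> r != 0 ->
  invertible (h + (0 +i* r) *: 1).
Proof.
(* This [s] satisfies r s = |h|^2, so (r + s)^2 = r^2 + 2 |h|^2 + s^2 exceeds |h|^2 + s^2, a bound
   for |h - i s|^2. *)
move=> sh r0; pose s := r * (cnorm h ^+ 2 / r ^+ 2).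
have r2 : 0 < r ^+ 2 by rewrite exprn_even_gt0.
have -> : h + (0 +i* r) *: 1 = (0 +i* (r + s)) *: 1 - - (h + (0 +i* (- s)) *: 1).
  rewrite opprK addrCA -scalerDl; congr (_ + _ *: _).
  by apply/eqP; rewrite eq_complex /=; apply/andP; split; apply/eqP; ring.
apply: neumann; rewrite cnormN normc_def /= expr0n /= add0r sqrtr_sqr ltcR.
rewrite -(ltr_pXn2r (n := 2))// ?nnegrE ?cnorm_ge0//.
rewrite -cnorm_star sqr_add_imag// real_normK ?num_real//.
apply: le_lt_trans (cnormD _ _) _.
rewrite cnorm_sqr_sa// cnorm_real ger0_norm ?sqr_ge0//.
have rsE : r * s = cnorm h ^+ 2 by rewrite /s; field.
have := sqr_ge0 (cnorm h); rewrite sqrrN sqrrD -mulr_natl rsE; lra.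
Qed.

End Invertibility.

(** * Spectral radius of a self-adjoint element *)

Section SelfAdjointSpectralRadius.
Context {R : realType} {A : cstarAlgType R}.
Implicit Types (h u v : A) (r : R).

(** For x = u + i v, commutation gives x^* x = u^2 + v^2, so the right side is |x|^2, and 2 u = x +
    x^* gives |u| <= |x|. *)
Lemma cnorm_sqr_le_add u v : star u = u -> star v = v -> u * v = v * u ->
  cnorm u ^+ 2 <= cnorm (u * u + v * v).
Proof.
move=> su sv uv; pose x := u + (0 +i* 1) *: v.
have sx : star x = u - (0 +i* 1) *: v by rewrite starD starZi su sv.
have <- : star x * x = u * u + v * v.
  rewrite sx mulrDr !mulrDl !mulNr -!scalerAr -!scalerAl -uv scalerA.
  have -> : (0 +i* 1) * (0 +i* 1) = -1 :> R[i].
    by apply/eqP; rewrite eq_complex /=; apply/andP; split; apply/eqP; ring.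
  by rewrite scaleN1r opprK addrA subrK.
rewrite cnorm_star ler_pXn2r ?nnegrE ?cnorm_ge0//.
have : cnorm (2 *:r u) <= 2 * cnorm x.
  have -> : 2 *:r u = x + star x.
    by rewrite sx addrACA subrr addr0 rmorphD rmorph1 scalerDl scale1r.
  by have := cnormD x (star x); rewrite cnorm_starE; lra.
by rewrite cnorm_realZ ger0_norm//; lra.
Qed.

(* Values of polynomials at [h] commute, and identities between them reduce to
   identities in a commutative ring. *)
Definition sa h (P : {poly R[i]}) := star (horner_alg h P) = horner_alg h P.

Lemma sa_X h : star h = h -> sa h 'X.
Proof. by rewrite /sa horner_algX. Qed.

Lemma sa_M h P Q : sa h P -> sa h Q -> sa h (P * Q).
Proof. by move=> sP sQ; rewrite /sa [in LHS]mulrC !rmorphM starM sP sQ. Qed.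

Lemma sa_1 h : sa h 1.
Proof. by rewrite /sa rmorph1 star1. Qed.

Lemma sa_D h P Q : sa h P -> sa h Q -> sa h (P + Q).
Proof. by move=> sP sQ; rewrite /sa rmorphD starD sP sQ. Qed.

Lemma sa_N h P : sa h P -> sa h (- P).
Proof. by move=> sP; rewrite /sa rmorphN starN sP. Qed.

Lemma sa_exp h P n : sa h P -> sa h (P ^+ n).
Proof. by move=> sP; rewrite /sa rmorphXn starX sP. Qed.

(* (2 W G)^2 + (W (1 - G^2))^2 = (W (1 + G^2))^2. *)
Lemma cnorm_amgm h W G : sa h W -> sa h G ->
  2 * cnorm (horner_alg h (W * G)) <= cnorm (horner_alg h (W * (1 + G ^+ 2))).
Proof.
move=> sW sG.
have sG2 : sa h (G ^+ 2) by exact: sa_exp.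
have sWG : sa h ((W + W) * G) by apply/sa_M/sG/sa_D.
have sWm : sa h (W * (1 - G ^+ 2)) by apply/sa_M/sa_D/sa_N => //; exact: sa_1.
have sWp : sa h (W * (1 + G ^+ 2)) by apply/sa_M/sa_D => //; exact: sa_1.
have := cnorm_sqr_le_add sWG sWm.
rewrite -!rmorphM -rmorphD mulrC => /(_ erefl).
have -> : ((W + W) * G) * ((W + W) * G) +
    (W * (1 - G ^+ 2)) * (W * (1 - G ^+ 2)) =
    (W * (1 + G ^+ 2)) * (W * (1 + G ^+ 2)) by ring.
rewrite [X in _ <= cnorm X]rmorphM cnorm_sqr_sa// ler_pXn2r ?nnegrE ?cnorm_ge0//.
have -> : horner_alg h ((W + W) * G) = 2 *:r horner_alg h (W * G).
  by rewrite [(W + W) * G]mulrDl rmorphD /= rmorphD rmorph1 scalerDl scale1r.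
by rewrite cnorm_realZ ger0_norm.
Qed.

Lemma cnorm_sa_pow2 h k : star h = h -> cnorm (h ^+ (2 ^ k)) = cnorm h ^+ (2 ^ k).
Proof.
move=> sh; elim: k => [|k IH]; first by rewrite !expr1.
by rewrite expnSr !exprM expr2 cnorm_sqr_sa ?starX ?sh// IH.
Qed.

(* With g = h^2, the product q_k = (1 + g) (1 + g^2) ... (1 + g^(2^(k-1)))
   has norm at least 2^k by [cnorm_amgm], while q_k (1 - g) = 1 - g^(2^k) has
   norm at most 2; so 1 - g has no inverse. *)
Lemma unit_sa_not_invertible h : star h = h -> cnorm h = 1 ->
  ~ invertible (1 - h * h).
Proof.
move=> sh h1 [b [hb _]].
pose q k : {poly R[i]} := \prod_(j < k) (1 + ('X ^+ (2 ^ j)) ^+ 2).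
have sX n : sa h ('X ^+ n) by apply/sa_exp/sa_X.
have sq k : sa h (q k).
  rewrite /q; apply: (big_ind (sa h)); [exact: sa_1 | exact: sa_M |].
  by move=> j _; apply: sa_D; [exact: sa_1 | exact/sa_exp].
(* Each new factor is handled by [cnorm_amgm] with G = X^(2^k), which gains a factor 2 and shifts
   the exponent by 2^k; the free [m] absorbs the shift. The shifts add up to 1 + 2 + ... + 2^(k-1) =
   2^k - 1. *)
have qlow k m : 2 ^+ k * cnorm (h ^+ (m + (2 ^ k).-1)%N) <=
    cnorm (horner_alg h ('X ^+ m * q k)).
  elim: k m => [|k IH] m.
    by rewrite addn0 mul1r /q big_ord0 mulr1 rmorphXn /= horner_algX.
  rewrite /q big_ord_recr /= -/(q k) mulrA.
  apply: le_trans _ (cnorm_amgm (sa_M (sX _) (sq _)) (sX _)).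
  rewrite exprS -mulrA ler_pM2l// mulrAC -exprD; apply: le_trans _ (IH _).
  rewrite -addnA; have -> // : (2 ^ k + (2 ^ k).-1)%N = (2 ^ k.+1).-1.
  rewrite expnS mul2n -addnn. by case: (2 ^ k)%N (expn_gt0 2 k) => // n _; rewrite addnS.
(* 1 = |h^(2^k)| <= |h^(2^k - 1)| |h|, and |h| = 1. *)
have hpow k : 1 <= cnorm (h ^+ (2 ^ k).-1).
  have := cnormM (h ^+ (2 ^ k).-1) h.
  by rewrite -exprSr prednK ?expn_gt0// cnorm_sa_pow2// h1 expr1n mulr1.
have qtel k : q k * (1 - 'X * 'X) = 1 - 'X ^+ (2 ^ k) ^+ 2.
  elim: k => [|k IH]; first by rewrite /q big_ord0 expr1 expr2 mul1r.
  rewrite /q big_ord_recr /= -/(q k) mulrAC IH expnSr [in RHS]exprM; ring.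
(* An inverse b of 1 - h^2 gives q_k = (1 - h^(2^(k+1))) b, hence a bound uniform in k. *)
have qb k : 2 ^+ k <= 2 * cnorm b.
  have -> : 2 * cnorm b = (1 + 1) * cnorm b by [].
  apply: le_trans (_ : cnorm (horner_alg h (q k)) <= _).
    apply: le_trans _ (_ : _ <= cnorm (horner_alg h ('X ^+ 0 * q k))) _.
      apply: le_trans (qlow k 0); rewrite add0n ler_peMr ?exprn_ge0//.
    by rewrite mul1r.
  have -> : horner_alg h (q k) = (1 - h ^+ (2 ^ k.+1)) * b.
    have := congr1 (horner_alg h) (qtel k).
    rewrite rmorphM !rmorphB rmorphM rmorph1 !rmorphXn /= !horner_algX => e.
    by rewrite expnSr exprM -e -mulrA hb mulr1.
  apply: le_trans (cnormM _ _) _; rewrite ler_wpM2r ?cnorm_ge0//.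
  apply: le_trans (cnormB _ _) _.
  by rewrite cnorm1 cnorm_sa_pow2// h1 expr1n.
have := archi_boundP (mulr_ge0 (ler0n R 2) (cnorm_ge0 b)).
set k := Num.bound _; have : k%:R <= 2 ^+ k :> R.
  by rewrite -natrX ler_nat ltnW// ltn_expl.
by have := qb k; lra.
Qed.

(** After scaling to norm one, 1 - h^2 = (1 - h) (1 + h) would be a product of invertibles. In
    spectral terms, r or -r lies in the spectrum of h. *)
Lemma sa_not_invertible h r : star h = h -> cnorm h = r -> 0 < r ->
  ~ (invertible (r%:S - h) /\ invertible (r%:S + h)).
Proof.
move=> sh hr r0 [ih ih']; apply: (@unit_sa_not_invertible (r^-1 *:r h)).
- by rewrite star_realZ sh.
- by rewrite cnorm_realZ hr ger0_norm ?invr_ge0 ?ltW// mulVf// gt_eqF.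
have rr : r^-1 * r = 1 by rewrite mulVf// gt_eqF.
have -> : 1 - (r^-1 *:r h) * (r^-1 *:r h) =
    (r^-1 *:r (r%:S - h)) * (r^-1 *:r (r%:S + h)).
  rewrite scalerBr scalerDr realZA rr realZ1.
  by rewrite mulrBl mul1r mulrDr mulr1 opprD addrA addrK.
have r'0 : r^-1%:C != 0 by rewrite fmorph_eq0 invr_eq0 gt_eqF.
by apply: invertibleM; apply: invertibleZ.
Qed.

End SelfAdjointSpectralRadius.

(** * The positive cone and square roots *)

Section Positivity.
Context {R : realType} {A : cstarAlgType R}.
Implicit Types (c e h p q : A) (r t M : R).

(** By [invertible_add_imag] the spectrum of a self-adjoint element is real, so only the points -t
    with t > 0 have to be excluded. *)
Lemma cstar_posP p : cstar_pos p <->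
  star p = p /\ forall t, 0 < t -> invertible (p + t%:S).
Proof.
split=> -[sp pp]; split=> //.
  move=> t t0; apply: contrapT => np.
  have : spectrum p (- t)%:C.
    by move=> /invertibleN; rewrite opprB realZN opprK.
  by move=> /pp; rewrite ler0c; lra.
case=> x y; have [-> xz|y0 []] := eqVneq y 0.
  have [x0|x0] := leP 0 x; first by rewrite (ler0c x).
  case: xz; apply/invertibleN; rewrite opprB -realZN; apply: pp; lra.
apply/invertibleN; rewrite opprB.
have -> : p - (x +i* y) *: 1 = (p - x%:S) + (0 +i* (- y)) *: 1.
  rewrite -addrA -realZN -scalerDl -scaleNr; congr (_ + _ *: _).
  by apply/eqP; rewrite eq_complex /= addr0 add0r !eqxx.
by apply: invertible_add_imag; rewrite ?oppr_eq0// starB star_real sp.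
Qed.

Lemma pos_sa p : cstar_pos p -> star p = p.
Proof. by case. Qed.

Lemma pos_invertible p t : cstar_pos p -> 0 < t -> invertible (p + t%:S).
Proof. by move=> /cstar_posP[_]; apply. Qed.

(** If p is positive and N = |M - p| > M, then N - (M - p) = p + (N - M) is invertible by positivity
    and N + (M - p) by Neumann, against [sa_not_invertible]. Conversely, p + t = (M + t) - (M - p)
    is invertible by Neumann. *)
Lemma pos_normP p M : star p = p -> cnorm p <= M ->
  cstar_pos p <-> cnorm (M%:S - p) <= M.
Proof.
move=> sp pM; split=> [pp|Mp].
  rewrite leNgt; apply/negP; set N := cnorm _ => MN.
  have M0 := le_trans (cnorm_ge0 p) pM.
  apply: (@sa_not_invertible R A (M%:S - p) N) => //.
  - by rewrite starB star_real sp.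
  - lra.
  split.
    rewrite opprB addrCA -realZB; apply: pos_invertible => //; lra.
  rewrite addrA -realZD; apply: neumann_real; rewrite ger0_norm; lra.
apply/cstar_posP; split=> // t t0.
have -> : p + t%:S = (M + t)%:S - (M%:S - p).
  by rewrite opprB realZD [M%:S + _]addrC -addrA [M%:S + _]addrCA subrr addr0 addrC.
have M0 := le_trans (cnorm_ge0 p) pM.
by apply: neumann_real; rewrite ger0_norm; lra.
Qed.

(** With M = |p| + |q|, [pos_normP] reduces this to the triangle inequality. *)
Lemma posD p q : cstar_pos p -> cstar_pos q -> cstar_pos (p + q).
Proof.
move=> pp pq; have sp := pos_sa pp; have sq := pos_sa pq.
apply/(pos_normP (M := cnorm p + cnorm q)); rewrite ?starD ?sp ?sq ?cnormD//.
rewrite realZD opprD addrACA; apply: le_trans (cnormD _ _) _.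
by apply: lerD; apply/pos_normP.
Qed.

Lemma posZ r p : 0 <= r -> cstar_pos p -> cstar_pos (r *:r p).
Proof.
move=> r0 pp; have sp := pos_sa pp.
apply/(pos_normP (M := r * cnorm p)).
- by rewrite star_realZ sp.
- by rewrite cnorm_realZ ger0_norm.
rewrite -realZA -scalerBr cnorm_realZ ger0_norm// ler_wpM2l//.
exact/pos_normP.
Qed.

Lemma pos_norm_sub p M : star p = p -> cnorm p <= M -> cstar_pos (M%:S - p).
Proof.
move=> sp pM; apply/cstar_posP; split; first by rewrite starB star_real sp.
move=> t t0; rewrite addrAC -realZD; have M0 := le_trans (cnorm_ge0 p) pM.
by apply: neumann_real; rewrite ger0_norm; lra.
Qed.

Lemma pos_real r : 0 <= r -> cstar_pos (r%:S : A).
Proof.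
by move=> r0; rewrite -[r%:S]subr0; apply: pos_norm_sub; rewrite ?star0 ?cnorm0.
Qed.

(** If |p| > M, then |p| - p = (M - p) + (|p| - M) and |p| + p are both invertible, against
    [sa_not_invertible]. *)
Lemma pos_cnorm_le p M : 0 <= M -> cstar_pos p -> cstar_pos (M%:S - p) ->
  cnorm p <= M.
Proof.
move=> M0 pp pMp; rewrite leNgt; apply/negP => MN.
have sp := pos_sa pp.
apply: (@sa_not_invertible R A p (cnorm p)) => //; first by lra.
split.
  have -> : (cnorm p)%:S - p = (M%:S - p) + (cnorm p - M)%:S.
    by rewrite addrAC realZB [M%:S + _]addrC subrK.
  by apply: pos_invertible => //; lra.
by rewrite addrC; apply: pos_invertible => //; lra.
Qed.

Lemma cnorm_pos_mono p q : cstar_pos p -> p <=* q -> cnorm p <= cnorm q.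
Proof.
move=> pp pq; apply: pos_cnorm_le => //; first exact: cnorm_ge0.
have sq : star q = q.
  by rewrite -(subrK p q) starD (pos_sa pq) (pos_sa pp).
have -> : (cnorm q)%:S - p = ((cnorm q)%:S - q) + (q - p).
  by rewrite addrA subrK.
by apply: posD => //; apply: pos_norm_sub.
Qed.

Lemma pos_closed p :
  (forall r, 0 < r -> exists2 q, cstar_pos q & cnorm (p - q) < r) -> cstar_pos p.
Proof.
move=> hp.
have sp : star p = p.
  apply/eqP; rewrite -subr_eq0; apply/eqP/cnorm_eq0/eqP.
  rewrite eq_le cnorm_ge0 andbT; apply/ler_addgt0Pr => e e0; rewrite add0r.
  have [|q pq hq] := hp (e / 2); first by lra.
  have := cnorm_dist_triangle q (star p) p.
  by rewrite -{1}(pos_sa pq) -starB cnorm_starE (cnorm_distrC q); lra.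
apply/(pos_normP (M := cnorm p + 1)) => //; first by lra.
apply/ler_addgt0Pr => e e0.
(* The cap 1 on the distance ensures |q| <= |p| + 1, so that [pos_normP] applies to q with the same
   M. *)
have [|q pq hq] := hp (Num.min e 1); first by rewrite lt_min e0/=.
move: hq; rewrite lt_min => /andP[hqe hq1].
have := cnorm_dist_triangle ((cnorm p + 1)%:S - q) ((cnorm p + 1)%:S - p) 0.
have -> : (cnorm p + 1)%:S - p - ((cnorm p + 1)%:S - q) = q - p.
  by rewrite opprB addrC addrA subrK.
rewrite !subr0 cnorm_distrC.
have /(pos_normP (pos_sa pq)) : cnorm q <= cnorm p + 1.
  by have := cnormB p (p - q); rewrite subKr; lra.
by move=> [/(_ pq)]; lra.
Qed.

(** With s = sqrt t, h^2 + t = (h - i s) (h + i s) is a product of invertibles. *)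
Lemma pos_sqr h : star h = h -> cstar_pos (h * h).
Proof.
move=> sh; apply/cstar_posP; split; first by rewrite starM sh.
move=> t t0; rewrite -(sqr_sqrtr (ltW t0)) -sqr_add_imag//.
have st0 : Num.sqrt t != 0 by rewrite gt_eqF// sqrtr_gt0.
apply: invertibleM; last exact: invertible_add_imag.
rewrite starD sh starZi star1 -scaleNr.
have -> : - (0 +i* Num.sqrt t) = 0 +i* (- Num.sqrt t) :> R[i].
  by apply/eqP; rewrite eq_complex /= oppr0 !eqxx.
by apply: invertible_add_imag => //; rewrite oppr_eq0.
Qed.

Lemma sa_inverse c e : star c = c -> c * e = 1 -> e * c = 1 -> star e = e.
Proof.
move=> sc ce ec; rewrite -[LHS]mulr1 -ce mulrA -{1}sc -starM ce star1 mul1r//.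
Qed.

(* c p c + t = c (p + t c^-2) c, and c^-2 dominates 1 / |c|^2. *)
Lemma pos_conj c e p : star c = c -> c * e = 1 -> e * c = 1 ->
  cstar_pos p -> cstar_pos (c * p * c).
Proof.
move=> sc ce ec pp; have se := sa_inverse sc ce ec.
have ic : invertible c by exists e.
have cc0 : 0 <= cnorm (c * c) by exact: cnorm_ge0.
(* The summand 1 makes d positive at once and gives d |c^2| = 1 - d < 1. *)
pose d := (1 + cnorm (c * c))^-1.
have d0 : 0 < d by rewrite /d invr_gt0; lra.
have peed : cstar_pos (e * e - d%:S).
  apply/cstar_posP; split; first by rewrite starB star_real starM se.
  move=> t t0; rewrite -addrA [- _ + _]addrC -realZB.
  have [td|td] := ltP d t.
    by apply: (pos_invertible (pos_sqr se)); rewrite subr_gt0.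
  (* For t <= d the element is e^2 times a Neumann perturbation of 1, as (d - t) |c^2| < 1. *)
  have -> : e * e + (t - d)%:S = (e * e) * (1 - (d - t) *:r (c * c)).
    rewrite mulrBr mulr1 -scalerAr -mulrA [e * (c * c)]mulrA ec mul1r ec.
    by rewrite -realZN opprB.
  apply: invertibleM; first by apply: invertibleM; exists c.
  apply: neumann1; rewrite cnorm_realZ ger0_norm ?subr_ge0//.
  have : d * (1 + cnorm (c * c)) = 1 by rewrite mulVf// gt_eqF//; lra.
  have : 0 <= t * cnorm (c * c) by apply: mulr_ge0 => //; exact: ltW.
  by rewrite mulrBl mulrDr mulr1; lra.
apply/cstar_posP; split; first by rewrite !starM sc (pos_sa pp) mulrA.
move=> t t0.
(* The bracket equals p + t e^2; splitting off t d exhibits it as a positive element plus a positive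
   scalar. *)
have -> : c * p * c + t%:S =
    c * (p + t *:r (e * e - d%:S) + (t * d)%:S) * c.
  rewrite -addrA scalerBr realZA subrK mulrDr mulrDl -scalerAr -scalerAl.
  by rewrite mulrA ce mul1r ec.
do 2?[apply: invertibleM => //]; apply: pos_invertible; last exact: mulr_gt0.
by apply: posD => //; apply: posZ => //; exact: ltW.
Qed.

(* w = (y + w^2) / 2 exactly when (1 - w)^2 = 1 - y. *)
Lemma sqrt_one_sub y : star y = y -> cnorm y < 1 ->
  exists2 w, star w = w /\ cnorm w < 1 & (1 - w) * (1 - w) = 1 - y :> A.
Proof.
move=> sy y1; have y0 := cnorm_ge0 y.
pose f (w : A) := 2^-1 *:r (y + w * w).
have fball a : cnorm a <= cnorm y -> cnorm (f a) <= cnorm y.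
  move=> ay; rewrite cnorm_realZ ger0_norm ?invr_ge0//.
  have := cnormD y (a * a); have := cnormM a a.
  have : cnorm a * cnorm a <= cnorm y * 1.
    by apply: ler_pM; rewrite ?cnorm_ge0//; lra.
  lra.
have fcontr a b : cnorm a <= cnorm y -> cnorm b <= cnorm y ->
    cnorm (f a - f b) <= cnorm y * cnorm (a - b).
  move=> ay by_; rewrite -scalerBr cnorm_realZ ger0_norm ?invr_ge0//.
  have -> : y + a * a - (y + b * b) = a * (a - b) + (a - b) * b.
    by rewrite mulrBr mulrBl addrA subrK opprD addrACA subrr add0r.
  have := cnormD (a * (a - b)) ((a - b) * b).
  have := cnormM a (a - b); have := cnormM (a - b) b.
  have := ler_wpM2r (cnorm_ge0 (a - b)) ay.
  have := ler_wpM2r (cnorm_ge0 (a - b)) by_.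
  rewrite [cnorm (a - b) * cnorm b]mulrC; lra.
have y01 : 0 <= cnorm y < 1 by rewrite y0.
have [w wy fw] := ball_fixpoint y01 y0 fball fcontr.
(* The adjoint of w is again a fixed point in the ball, and a strict contraction has only one; so w
   is self-adjoint. *)
have fsw : f (star w) = star w.
  by rewrite -[in RHS]fw /f star_realZ starD starM sy.
exists w; first split.
- apply/eqP; rewrite -subr_eq0; apply/eqP/cnorm_eq0/eqP.
  rewrite eq_le cnorm_ge0 andbT leNgt; apply/negP => d0.
  have := fcontr (star w) w; rewrite cnorm_starE fsw fw => /(_ wy wy).
  by rewrite leNgt gtr_pMl// y1.
- by lra.
have ww : 2 *:r w = y + w * w.
  by rewrite -{1}fw /f realZA divff ?pnatr_eq0// realZ1.
have -> : y = 2 *:r w - w * w by rewrite ww addrK.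
have -> : 2 *:r w = w + w by rewrite rmorphD rmorph1 scalerDl scale1r.
rewrite mulrBl mul1r mulrBr mulr1 !opprB opprD !addrA; congr (_ - w).
exact: addrAC.
Qed.

(** With M = |p| + t and y = (|p| - p) / M one has p + t = M (1 - y), and positivity of p gives |y|
    <= |p| / M < 1. If (1 - w)^2 = 1 - y with |w| < 1, then sqrt M (1 - w) is an invertible root. *)
Lemma pos_sqrt p t : cstar_pos p -> 0 < t ->
  exists c e, [/\ star c = c, c * e = 1, e * c = 1 & c * c = p + t%:S].
Proof.
move=> pp t0; pose M := cnorm p + t.
have sp := pos_sa pp.
have M0 : 0 < M by have := cnorm_ge0 p; rewrite /M; lra.
have MV : M * M^-1 = 1 by rewrite divff// gt_eqF.
pose y : A := M^-1 *:r ((cnorm p)%:S - p).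
have sy : star y = y by rewrite star_realZ starB star_real sp.
have y1 : cnorm y < 1.
  rewrite cnorm_realZ ger0_norm ?invr_ge0 ?ltW//.
  rewrite mulrC ltr_pdivrMr// mul1r.
  by apply: le_lt_trans (_ : cnorm p < M); [apply/pos_normP | rewrite /M; lra].
have [w [sw w1] wE] := sqrt_one_sub sy y1.
have [b [wb bw]] := neumann1 w1.
have s0 : Num.sqrt M != 0 by rewrite gt_eqF// sqrtr_gt0.
exists (Num.sqrt M *:r (1 - w)), ((Num.sqrt M)^-1 *:r b); split.
- by rewrite star_realZ starB star1 sw.
- by rewrite -scalerAl -scalerAr realZA divff// realZ1.
- by rewrite -scalerAl -scalerAr realZA mulVf// realZ1.
rewrite -scalerAl -scalerAr realZA -expr2 sqr_sqrtr ?ltW// wE scalerBr realZA.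
rewrite MV realZ1 /M realZD opprB [_%:S + _]addrC -addrA.
by rewrite [(cnorm p)%:S + _]addrCA subrr addr0 addrC.
Qed.

End Positivity.

(** * Limits and the order *)

Section OrderLimits.
Context {R : realType} {A : cstarAlgType R}.
Implicit Types (u v : nat -> A) (p q l : A) (r t : R).

Lemma cnorm_cvgD u v l l' : norm_cvg cnorm u l -> norm_cvg cnorm v l' ->
  norm_cvg cnorm (fun n => u n + v n) (l + l').
Proof.
move=> /cnorm_cvgP ul /cnorm_cvgP vl; apply/cnorm_cvgP => e e0.
have e20 : 0 < e / 2 by lra.
have [n hn] := ul _ e20; have [m hm] := vl _ e20.
exists (maxn n m) => k; rewrite geq_max => /andP[/hn hk /hm hk'].
by rewrite opprD addrACA; apply: le_lt_trans (cnormD _ _) _; lra.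
Qed.

Lemma cnorm_cvgM u l p q : norm_cvg cnorm u l ->
  norm_cvg cnorm (fun n => p * u n * q) (p * l * q).
Proof.
apply: (@cnorm_cvg_lipschitz _ _ (fun a => p * a * q) (cnorm p * cnorm q)) => a b.
rewrite -mulrBl -mulrBr; apply: le_trans (cnormM _ _) _.
by rewrite mulrAC ler_wpM2r ?cnorm_ge0// cnormM.
Qed.

Lemma cnorm_cvgZ u l r : norm_cvg cnorm u l ->
  norm_cvg cnorm (fun n => r *:r u n) (r *:r l).
Proof.
apply: (@cnorm_cvg_lipschitz _ _ (fun a => r *:r a) `|r|) => a b.
by rewrite -scalerBr cnorm_realZ.
Qed.

Lemma cnorm_cvgB u v l l' : norm_cvg cnorm u l -> norm_cvg cnorm v l' ->
  norm_cvg cnorm (fun n => u n - v n) (l - l').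
Proof.
move=> ul /(cnorm_cvgZ (-1)) vl; have := cnorm_cvgD ul vl.
rewrite realZN realZ1; congr (norm_cvg _ _ _).
by apply/funext => n; rewrite realZN realZ1.
Qed.

Lemma pos_lim u l :
  (forall n, cstar_pos (u n)) -> norm_cvg cnorm u l -> cstar_pos l.
Proof.
move=> up /cnorm_cvgP ul; apply: pos_closed => r /ul[n /(_ n (leqnn _)) hn].
by exists (u n) => //; rewrite cnorm_distrC.
Qed.

Lemma pos_sum (I : Type) (s : seq I) (P : pred I) (F : I -> A) :
  (forall i, P i -> cstar_pos (F i)) -> cstar_pos (\sum_(i <- s | P i) F i).
Proof.
move=> FP; elim/big_ind: _ => //; last exact: posD.
by rewrite -(scale0r 1); apply: (pos_real (lexx 0)).
Qed.

Lemma cstar_le_trans q p l : p <=* q -> q <=* l -> p <=* l.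
Proof. by move=> pq ql; rewrite /cstar_le -(subrK q l) -addrA; apply: posD. Qed.

Lemma cstar_leZ r p q : 0 <= r -> p <=* q -> r *:r p <=* r *:r q.
Proof. by move=> r0 pq; rewrite /cstar_le -scalerBr; apply: posZ. Qed.

Lemma cstar_leZr r t p : cstar_pos p -> r <= t -> r *:r p <=* t *:r p.
Proof. by move=> pp rt; rewrite /cstar_le -realZB; apply: posZ; rewrite ?subr_ge0. Qed.

Lemma cstar_leD p q p' q' : p <=* q -> p' <=* q' -> p + p' <=* q + q'.
Proof. by move=> pq pq'; rewrite /cstar_le opprD addrACA; apply: posD. Qed.

Lemma cstar_le_approx p q :
  (forall r, 0 < r -> exists2 q', p <=* q' & cnorm (q' - q) < r) -> p <=* q.
Proof.
move=> h; apply: pos_closed => r /h[q' pq' qq']; exists (q' - p) => //.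
by rewrite opprB addrA subrK cnorm_distrC.
Qed.

(* Linear identities among three elements of A reduce to identities among their
   real coefficients. *)
Definition lin3 (a b c : R) p q l : A := a *:r p + b *:r q + c *:r l.

Lemma lin3B (a b c a' b' c' : R) p q l :
  lin3 a b c p q l - lin3 a' b' c' p q l = lin3 (a - a') (b - b') (c - c') p q l.
Proof. by rewrite /lin3 !opprD addrACA [X in X + _]addrACA -!realZB. Qed.

Lemma lin3Z r (a b c : R) p q l :
  r *:r lin3 a b c p q l = lin3 (r * a) (r * b) (r * c) p q l.
Proof. by rewrite /lin3 !scalerDr !realZA. Qed.

End OrderLimits.

(** * Inner product calculus and quadratic estimates *)

Section HilbertModule.
Context {R : realType} {A : cstarAlgType R} {H : hilbertModType A}.
Implicit Types (x y z : H) (a : A) (r t : R).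

Lemma inner0l z : inner (0 : H) z = 0.
Proof.
have := inner_linear 1 0 0 z; rewrite scaler0 addr0 mul1r.
by move=> /(congr1 (fun w => w - inner 0 z)); rewrite subrr addrK.
Qed.

Lemma innerDl x y z : inner (x + y) z = inner x z + inner y z.
Proof. by have := inner_linear 1 x y z; rewrite scale1r mul1r. Qed.

Lemma innerZl a x z : inner (a *: x) z = a * inner x z.
Proof. by have := inner_linear a x 0 z; rewrite inner0l !addr0. Qed.

Lemma innerDr x y z : inner z (x + y) = inner z x + inner z y.
Proof. by rewrite inner_star innerDl starD -!inner_star. Qed.

Lemma innerZr a x z : inner z (a *: x) = inner z x * star a.
Proof. by rewrite inner_star innerZl starM -inner_star. Qed.

Lemma innerZZ a x : inner (a *: x) (a *: x) = a * inner x x * star a.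
Proof. by rewrite innerZl innerZr mulrA. Qed.

Lemma inner_ext x y : (forall z, inner x z = inner y z) -> x = y.
Proof.
move=> xy; apply/eqP; rewrite -subr_eq0; apply/eqP/inner_eq0.
by rewrite innerDl xy -innerDl subrr inner0l.
Qed.

Lemma is_adjoint_sym (T T' : H -> H) : is_adjoint T T' -> is_adjoint T' T.
Proof. by move=> TT' x y; rewrite inner_star -TT' -inner_star. Qed.

(** The type ['End*(H)] records only the existence of an adjoint; homogeneity follows by pairing
    with all vectors. *)
Lemma is_adjointZ (T T' : H -> H) a x : is_adjoint T T' -> T (a *: x) = a *: T x.
Proof. by move=> TT'; apply: inner_ext => y; rewrite TT' !innerZl TT'. Qed.

Lemma adjointableZ (T : 'End*(H)) a x : T (a *: x) = a *: T x.
Proof. exact: is_adjointZ (@adjointP _ _ _ T). Qed.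

Lemma adjointZ (T : 'End*(H)) a x : adjoint T (a *: x) = a *: adjoint T x.
Proof. exact: is_adjointZ (is_adjoint_sym (@adjointP _ _ _ T)). Qed.

Lemma inner_addZ r x y :
  inner (x + r%:S *: y) (x + r%:S *: y) =
  lin3 1 r (r ^+ 2) (inner x x) (inner x y + inner y x) (inner y y).
Proof.
rewrite innerDl !innerDr !innerZl !innerZr star_real !realMr !realMl.
by rewrite /lin3 realZ1 scalerDr -!addrA realZA.
Qed.

Lemma inner_sub x y :
  inner (x - y) (x - y) =
  lin3 1 (-1) 1 (inner x x) (inner x y + inner y x) (inner y y).
Proof.
have := inner_addZ (-1) x y.
by rewrite realZN realZ1 scaleN1r sqrrN expr1n.
Qed.

(** The right side minus the left is t <x + t^-1 y, x + t^-1 y>. *)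
Lemma inner_sub_le t x y : 0 < t ->
  inner (x - y) (x - y) <=* (1 + t) *:r inner x x + (1 + t^-1) *:r inner y y.
Proof.
move=> t0; have tV : t * t^-1 = 1 by rewrite divff// gt_eqF.
have := posZ (ltW t0) (inner_ge0 (x + t^-1%:S *: y)).
rewrite /cstar_le inner_addZ lin3Z inner_sub.
set p := inner x x; set q := _ + _; set l := inner y y.
have -> : (1 + t) *:r p + (1 + t^-1) *:r l = lin3 (1 + t) 0 (1 + t^-1) p q l.
  by rewrite /lin3 scale0r addr0.
rewrite lin3B; congr (cstar_pos (lin3 _ _ _ _ _ _)).
- ring.
- by rewrite tV; ring.
- by rewrite expr2 mulrA tV; ring.
Qed.

(** The right side minus the left is t <x - t^-1 y, x - t^-1 y>. *)
Lemma inner_sub_ge t x y : 0 < t ->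
  (1 - t) *:r inner x x + (1 - t^-1) *:r inner y y <=* inner (x - y) (x - y).
Proof.
move=> t0; have tV : t * t^-1 = 1 by rewrite divff// gt_eqF.
have := posZ (ltW t0) (inner_ge0 (x + (- t^-1)%:S *: y)).
rewrite /cstar_le inner_addZ lin3Z inner_sub.
set p := inner x x; set q := _ + _; set l := inner y y.
have -> : (1 - t) *:r p + (1 - t^-1) *:r l = lin3 (1 - t) 0 (1 - t^-1) p q l.
  by rewrite /lin3 scale0r addr0.
rewrite lin3B; congr (cstar_pos (lin3 _ _ _ _ _ _)).
- ring.
- by rewrite mulrN tV subr0.
- by rewrite sqrrN expr2 mulrA tV; ring.
Qed.

End HilbertModule.

(** Serves to let t decrease to r: the estimates contain t^-1, while r may be 0. Closedness of the
    cone gives the limit. *)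
Lemma pos_right_lim (R : realType) (A : cstarAlgType R) (g : R -> R)
    (C r r1 : R) (p q : A) : r < r1 ->
    (forall t, r < t < r1 -> `|g r - g t| <= C * (t - r)) ->
    (forall t, r < t < r1 -> cstar_pos (p + g t *:r q)) ->
  cstar_pos (p + g r *:r q).
Proof.
move=> rr1 gC gpos; apply: pos_closed => e e0.
have c0 : 0 < `|C| * cnorm q + 1.
  by have := mulr_ge0 (normr_ge0 C) (cnorm_ge0 q); lra.
(* The first bound keeps r + d inside the interval, the second makes |C| d |q| < e. *)
pose d := Num.min ((r1 - r) / 2) (e / (`|C| * cnorm q + 1)).
have d0 : 0 < d by rewrite lt_min; apply/andP; split; [lra | exact: divr_gt0].
have : d <= (r1 - r) / 2 /\ d <= e / (`|C| * cnorm q + 1).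
  by rewrite !ge_min !lexx orbT.
move=> [dr1]; rewrite ler_pdivlMr// => de.
have rt : r < r + d < r1 by apply/andP; split; lra.
exists (p + g (r + d) *:r q); first exact: gpos.
rewrite opprD addrACA subrr add0r -realZB cnorm_realZ.
apply: le_lt_trans (_ : `|C| * d * cnorm q < e).
  apply: ler_wpM2r; first exact: cnorm_ge0.
  have := gC _ rt; rewrite [r + d - r]addrAC subrr add0r => /le_trans; apply.
  by rewrite ler_wpM2r ?ler_norm// ltW.
by lra.
Qed.

(** * Frame series and their perturbation *)

Section FrameSums.
Context {R : realType} {A : cstarAlgType R} {H : hilbertModType A}.
Variable J : set nat.
Implicit Types (T S : nat -> H -> H) (x : H) (u d s : A) (r t : R).

Lemma frame_sum_pos T x s : frame_sum J T x s -> cstar_pos s.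
Proof. by apply: pos_lim => n; apply: pos_sum => i _; exact: inner_ge0. Qed.

Lemma frame_sum_scale T x a s s' :
    (forall i, T i (a *: x) = a *: T i x) ->
    frame_sum J T x s -> frame_sum J T (a *: x) s' ->
  s' = a * s * star a.
Proof.
move=> Ta xs xs'; apply: cnorm_cvg_unique xs' _.
have := cnorm_cvgM a (star a) xs; congr (norm_cvg _ _ _); apply/funext => n.
by rewrite mulr_sumr mulr_suml; apply: eq_bigr => i _; rewrite Ta innerZZ.
Qed.

(** Termwise from S = T - (T - S). General windows from m to n serve both the Cauchy criterion and,
    with m = 0, the passage to the limit. *)
Lemma frame_partial_sub T S x m n t : 0 < t ->
  let part T := \sum_(m <= i < n | i \in J) inner (T i x) (T i x) in
  (1 - t) *:r part T + (1 - t^-1) *:r part (fun i => T i \- S i) <=* part S /\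
  part S <=* (1 + t) *:r part T + (1 + t^-1) *:r part (fun i => T i \- S i).
Proof.
move=> t0 part.
rewrite /part !scaler_sumr -!big_split /cstar_le -!sumrB.
split; apply: pos_sum => i _.
  by have := inner_sub_ge (T i x) (T i x - S i x) t0; rewrite subKr.
by have := inner_sub_le (T i x) (T i x - S i x) t0; rewrite subKr.
Qed.

Lemma frame_partial_split T x m n : (m <= n)%N ->
  \sum_(m <= i < n | i \in J) inner (T i x) (T i x) =
  \sum_(0 <= i < n | i \in J) inner (T i x) (T i x) -
  \sum_(0 <= i < m | i \in J) inner (T i x) (T i x).
Proof. by move=> mn; rewrite (big_cat_nat (leq0n m) mn)/= addrC addrK. Qed.

Lemma frame_sum_tail T x s r : frame_sum J T x s -> 0 < r ->
  exists n0, forall m n, (n0 <= m)%N -> (m <= n)%N ->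
    cnorm (\sum_(m <= i < n | i \in J) inner (T i x) (T i x)) < r.
Proof.
move=> /cnorm_cvgP xs r0; have r20 : 0 < r / 2 by lra.
have [n0 hn] := xs _ r20; exists n0 => m n n0m mn.
rewrite frame_partial_split//; apply: le_lt_trans (cnorm_dist_triangle s _ _) _.
have := hn _ n0m; have := hn _ (leq_trans n0m mn); rewrite [cnorm (s - _)]cnorm_distrC.
by lra.
Qed.

(** At t = 1, each window of the S-series is at most twice the sum of the windows of the other two;
    the norm is monotone on positive elements, so the Cauchy property carries over. *)
Lemma frame_sum_sub_ex T S x u d :
  frame_sum J T x u -> frame_sum J (fun i => T i \- S i) x d ->
  exists s, frame_sum J S x s.
Proof.
move=> xu xd; apply: cnorm_complete.
set v := (v in norm_cauchy _ v).
suff tail e : 0 < e -> exists n0, forall m n, (n0 <= m)%N -> (m <= n)%N ->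
    cnorm (v n - v m) < e.
  move=> e /tail[n0 hn]; exists n0 => m n n0m n0n.
  by have [mn|/ltnW nm] := leqP m n; [rewrite cnorm_distrC|]; apply: hn.
move=> e0; have e40 : 0 < e / 4 by lra.
have [n1 h1] := frame_sum_tail xu e40; have [n2 h2] := frame_sum_tail xd e40.
exists (maxn n1 n2) => m n; rewrite geq_max => /andP[n1m n2m] mn.
rewrite /v -frame_partial_split//.
have [_ le] := frame_partial_sub T S x m n ltr01.
apply: le_lt_trans (cnorm_pos_mono _ le) _.
  by apply: pos_sum => i _; exact: inner_ge0.
apply: le_lt_trans (cnormD _ _) _; rewrite !cnorm_realZ invr1 ger0_norm ?addr_ge0//.
by have := h1 _ _ n1m mn; have := h2 _ _ n2m mn; lra.
Qed.

Lemma frame_sum_sub T S x u d s t : 0 < t ->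
  frame_sum J T x u -> frame_sum J (fun i => T i \- S i) x d ->
  frame_sum J S x s ->
  (1 - t) *:r u + (1 - t^-1) *:r d <=* s /\
  s <=* (1 + t) *:r u + (1 + t^-1) *:r d.
Proof.
move=> t0 xu xd xs; split; (apply: pos_lim; last first).
- exact: cnorm_cvgB xs (cnorm_cvgD (cnorm_cvgZ _ xu) (cnorm_cvgZ _ xd)).
- by move=> n; have [] := frame_partial_sub T S x 0 n t0.
- exact: cnorm_cvgB (cnorm_cvgD (cnorm_cvgZ _ xu) (cnorm_cvgZ _ xd)) xs.
- by move=> n; have [] := frame_partial_sub T S x 0 n t0.
Qed.

(* The norm inequality at c^-1 x, where c^2 = <K^* x, K^* x> + r, reads
   c^-1 d c^-1 <= alpha, whence d <= alpha c^2. *)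
Lemma frame_sum_le_of_cnorm_le (K : 'End*(H)) (D : nat -> H -> H) (alpha : R) x d :
    0 <= alpha ->
    (forall i a y, D i (a *: y) = a *: D i y) ->
    (forall y, exists s, frame_sum J D y s /\
       cnorm s <= alpha * cnorm (inner (adjoint K y) (adjoint K y))) ->
    frame_sum J D x d ->
  d <=* alpha *:r inner (adjoint K x) (adjoint K x).
Proof.
move=> alpha0 Dlin hD xd; set k := inner _ _.
have pk : cstar_pos k by exact: inner_ge0.
apply: cstar_le_approx => r r0; have a1 : 0 < alpha + 1 by lra.
(* This choice makes alpha t < r, also when alpha = 0. *)
pose t := r / (alpha + 1); have t0 : 0 < t by exact: divr_gt0.
exists (alpha *:r (k + t%:S)); last first.
  rewrite -scalerBr [k + _]addrC addrK realZA cnorm_real ger0_norm.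
    by rewrite mulrA ltr_pdivrMr// mulrC ltr_pM2l//; lra.
  by apply: mulr_ge0 => //; exact: ltW.
have [c [e [sc ce ec cc]]] := pos_sqrt pk t0.
have se := sa_inverse sc ce ec.
have [s' [exs' s'le]] := hD (e *: x).
have s'E := frame_sum_scale (fun i => Dlin i e x) xd exs'.
have ps' := frame_sum_pos exs'.
have ek : inner (adjoint K (e *: x)) (adjoint K (e *: x)) = e * k * e.
  by rewrite adjointZ innerZZ se.
(* Since k = c^2 - t, one has 1 - e k e = t e^2, which is positive. *)
have ek1 : cnorm (e * k * e) <= 1.
  apply: pos_cnorm_le => //; first by rewrite -ek; exact: inner_ge0.
  have -> : 1%:S - e * k * e = t *:r (e * e).
    have -> : k = c * c - t%:S by rewrite cc addrK.
    rewrite mulrBr mulrBl mulrA ec mul1r ce realZ1 opprB addrCA subrr addr0.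
    by rewrite realMr -scalerAl.
  by apply: posZ; [exact: ltW | exact: pos_sqr].
have s'a : cnorm s' <= alpha.
  by apply: le_trans s'le _; rewrite ek ler_piMr.
(* Here s' = e d e, so conjugating alpha - s' by c gives alpha (k + t) - d. *)
have := pos_conj sc ce ec (pos_norm_sub (pos_sa ps') s'a).
have -> // : c * (alpha%:S - s') * c = alpha *:r (k + t%:S) - d.
rewrite mulrBr mulrBl realMr -scalerAl cc s'E se; congr (_ - _).
by rewrite !mulrA ce mul1r -mulrA ec mulr1.
Qed.

End FrameSums.

(** * Frame bounds of the perturbed family *)

Theorem corollary5p3 (R : realType) (A : cstarAlgType R) (H : hilbertModType A)
    (K : 'End*(H)) (J : set nat) (T : nat -> 'End*(H)) (a b : R)
    (hT : K_operator_frame K J T a b)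
    (S : nat -> 'End*(H)) (alpha : R) (halpha0 : 0 <= alpha) (halpha : alpha < a)
    (hTS : forall x : H, exists s : A,
       frame_sum J (fun i => T i \- S i) x s /\
       cnorm s <= alpha * cnorm (inner (adjoint K x) (adjoint K x))) :
  K_operator_frame K J S
    (a * (1 - Num.sqrt (alpha / a)) ^+ 2)
    (b * (1 + Num.sqrt (alpha / a)) ^+ 2).
Proof.
case: hT => a0 b0 hT; set r := Num.sqrt _.
have r0 : 0 <= r := sqrtr_ge0 _.
have r2 : r ^+ 2 = alpha / a by rewrite sqr_sqrtr// divr_ge0// ltW.
have r1 : r < 1.
  by rewrite -(ltr_pXn2r (n := 2)) ?nnegrE// r2 expr1n ltr_pdivrMr// mul1r.
split; [by apply/mulr_gt0/exprn_gt0 => //; lra..|] => x.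
have [u [xu ku ux]] := hT x; have [d [xd _]] := hTS x.
have [s xs] := frame_sum_sub_ex xu xd; exists s.
have pu := frame_sum_pos xu.
have Dlin i c y : (T i \- S i) (c *: y) = c *: (T i \- S i) y.
  by rewrite /= !adjointableZ scalerBr.
(* As alpha = r^2 a, the lower frame bound of T turns alpha <K^* x, K^* x> into r^2 u. *)
have du : d <=* r ^+ 2 *:r u.
  apply: cstar_le_trans (frame_sum_le_of_cnorm_le halpha0 Dlin hTS xd) _.
  have -> : alpha = r ^+ 2 * a by rewrite r2 divfK// gt_eqF.
  by rewrite -realZA; apply: cstar_leZ => //; exact: sqr_ge0.
have dt t : r < t -> d <=* t ^+ 2 *:r u.
  move=> rt; apply: cstar_le_trans du _; apply: cstar_leZr => //.
  by rewrite ler_pXn2r ?nnegrE//; lra.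
have lower : (1 - r) ^+ 2 *:r u <=* s.
  (* On [0, 1] both (1 - t)^2 and (1 + t)^2 have Lipschitz constant at most 4. *)
  have := @pos_right_lim R A (fun t => - (1 - t) ^+ 2) 4 r 1 s u r1.
  rewrite /cstar_le -realZN; apply => t /andP[rt t1].
    by rewrite ler_norml; apply/andP; split; nra.
  have t0 : 0 < t by lra.
  have tV : t^-1 * t ^+ 2 = t by rewrite expr2 mulKf// gt_eqF.
  have [+ _] := frame_sum_sub t0 xu xd xs.
  rewrite realZN -/(cstar_le _ _); apply: cstar_le_trans.
  rewrite /cstar_le addrAC -realZB.
  (* For t < 1 the coefficient 1 - t^-1 of d is negative, so the upper bound on d yields a lower
     bound: the difference is (t^-1 - 1) (t^2 u - d). *)
  have -> : 1 - t - (1 - t) ^+ 2 = (t^-1 - 1) * t ^+ 2.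
    by rewrite mulrBl tV; ring.
  rewrite -[1 - t^-1]opprB realZN -realZA -scalerBr.
  apply: posZ (dt _ rt); rewrite subr_ge0 invf_ge1//; exact: ltW.
have upper : s <=* (1 + r) ^+ 2 *:r u.
  have := @pos_right_lim R A (fun t => (1 + t) ^+ 2) 4 r 1 (- s) u r1.
  rewrite /cstar_le /= [- s + _]addrC; apply => t /andP[rt t1].
    by rewrite ler_norml; apply/andP; split; nra.
  have t0 : 0 < t by lra.
  have tV : t^-1 * t ^+ 2 = t by rewrite expr2 mulKf// gt_eqF.
  have [_] := frame_sum_sub t0 xu xd xs.
  rewrite [- s + _]addrC => su; apply: (cstar_le_trans su).
  have -> : (1 + t) ^+ 2 = (1 + t) + (1 + t^-1) * t ^+ 2.
    by rewrite mulrDl tV; ring.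
  rewrite [X in _ <=* X]realZD; apply: cstar_leD.
    by rewrite /cstar_le subrr -(scale0r 1); apply: (pos_real (lexx 0)).
  by rewrite -realZA; apply: cstar_leZ (dt _ rt); rewrite addr_ge0// invr_ge0 ltW.
split=> //.
  apply: cstar_le_trans lower; rewrite [a * _]mulrC -(realZA _ a).
  by apply: cstar_leZ ku; exact: sqr_ge0.
apply: cstar_le_trans upper _; rewrite [b * _]mulrC -(realZA _ b).
by apply: cstar_leZ ux; exact: sqr_ge0.
Qed.
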